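(* Let $\mathcal{L}_\phi=k_\phi\mathcal{L}_R$ and let $\gamma,k_\phi$ be given such that $\gamma>k_\phi/(4V^{\mathrm{nom}})$. Consider the MTDC dynamics $$C_i\dot V_i=-\sum_{j\in\mathcal{N}_i}\frac{1}{R_{ij}}(V_i-V_j)+I_i^{\mathrm{inj}},\qquad i=1,\dots,n,$$ and the AC dynamics $$m_i\dot\omega_i=P_i^{\mathrm{gen}}+P_i^m-P_i^{\mathrm{inj}},\qquad i=1,\dots,n,$$ with $V^{\mathrm{nom}}I_i^{\mathrm{inj}}=P_i^{\mathrm{inj}}$, with the decentralized converter controller $$P_i^{\mathrm{inj}}=K_i^\omega(\omega_i-\omega^{\mathrm{ref}})+K_i^V(V_i^{\mathrm{ref}}-V_i),$$ and with one of the following two generation controllers: (a) the decentralized controller $P_i^{\mathrm{gen}}=-K_i^{\mathrm{droop}}(\omega_i-\omega^{\mathrm{ref}})$; or (b) the distributed controller $$P_i^{\mathrm{gen}}=-K_i^{\mathrm{droop}}(\omega_i-\omega^{\mathrm{ref}})-\frac{K_i^V}{K_i^\omega}K_i^{\mathrm{droop,I}}\eta_i,\qquad \dot\eta_i=K_i^{\mathrm{droop,I}}(\omega_i-\omega^{\mathrm{ref}})-\sum_{j\in\mathcal{N}_i}c^\eta_{ij}(\eta_i-\eta_j).$$ Then the equilibria of the resulting closed-loop systems (in state $(\omega,V)$ in case (a) and $(\omega,V,\eta)$ in case (b)) are globally asymptotically stable.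
   Context: There are $n$ HVDC converters, each connected to a single-generator AC system. $V_i$ is the DC voltage of converter $i$ and $\omega_i$ the frequency of AC system $i$. $C_i>0$, $m_i>0$, $R_{ij}=R_{ji}>0$, $V^{\mathrm{nom}}>0$; $K_i^\omega,K_i^V,K_i^{\mathrm{droop}},K_i^{\mathrm{droop,I}}>0$ are controller gains; $\omega^{\mathrm{ref}},V_i^{\mathrm{ref}}$ are constant reference values and $P_i^m$ are constants. $\mathcal{N}_i$ denotes the set of neighbors of $i$ in the relevant undirected graph on $\{1,\dots,n\}$: the connected graph of the MTDC (multi-terminal HVDC) grid in the voltage dynamics, and the communication graph in the controller, with $c^\eta_{ij}=c^\eta_{ji}>0$. $\mathcal{L}_R$ is the weighted Laplacian of the MTDC graph with edge weights $1/R_{ij}$. $\mathcal{L}_\phi$ is the weighted Laplacian of an undirected communication graph with edge weights $c^\phi_{ij}=c^\phi_{ji}>0$; it and $\gamma$ are parameters of a distributed converter controller, $P_i^{\mathrm{inj}}=K_i^\omega(\omega_i-\omega^{\mathrm{ref}})+K_i^V(V_i^{\mathrm{ref}}-V_i)+\sum_{j}c^\phi_{ij}(\phi_i-\phi_j)$, $\dot\phi_i=\frac{K_i^\omega}{K_i^V}(\omega_i-\omega^{\mathrm{ref}})-\gamma\phi_i$, and do not enter the decentralized converter controller considered here. *)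

(* Defs.v *)
From mathcomp Require Export all_boot all_order all_algebra.
From mathcomp Require Export all_classical all_reals all_analysis.
Export Order.TTheory GRing.Theory Num.Theory numFieldNormedType.Exports.

Set Implicit Arguments.
Unset Strict Implicit.
Unset Printing Implicit Defensive.

Local Open Scope classical_set_scope.
Local Open Scope ring_scope.

Section Stability.
Context {R : realType} {X : normedModType R}.
Implicit Types (f : X -> X) (x : R -> X) (xe : X).

(* Only the restriction of x to [0, +oo[ is constrained: the equation is imposed
   for t > 0, and at t = 0 only continuity from the right.  By the mean value
   theorem the equation then also holds at 0 for the right derivative,
   whenever f is continuous. *)
Definition is_solution f x : Prop :=
  {within `[0, +oo[, continuous x} /\
  forall t : R, 0 < t -> is_derive t 1 x (f (x t)).

Definition is_equilibrium f xe : Prop := f xe = 0.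

Definition lyapunov_stable f xe : Prop :=
  forall eps : R, 0 < eps ->
    exists2 delta : R, 0 < delta &
      forall x, is_solution f x -> `|x 0 - xe| < delta ->
        forall t : R, 0 <= t -> `|x t - xe| < eps.

Definition globally_attractive f xe : Prop :=
  forall x, is_solution f x -> x t @[t --> +oo] --> xe.

Definition globally_asymptotically_stable f xe : Prop :=
  lyapunov_stable f xe /\ globally_attractive f xe.

End Stability.

Section Graphs.
Context {R : realType} {n : nat}.
Implicit Types (e : rel 'I_n) (w : 'I_n -> 'I_n -> R).

Definition simple_graph e : Prop := symmetric e /\ irreflexive e.

Definition connected_graph e : Prop := forall i j, connect e i j.

(* The values of w off the edges of e are irrelevant. *)
Definition positive_symmetric_on e w : Prop :=
  forall i j, e i j -> 0 < w i j /\ w i j = w j i.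

Definition weighted_laplacian e w : 'M[R]_n :=
  \matrix_(i, j) if i == j then \sum_(k | e i k) w i k
                 else if e i j then - w i j else 0.

End Graphs.

Section Dynamics.
Context {R : realType} {n : nat}.
Implicit Types (omega V eta : 'cV[R]_n) (e : rel 'I_n).

Definition voltage_field e (Rline : 'I_n -> 'I_n -> R) (C : 'I_n -> R)
    (Iinj : 'I_n -> R) V : 'cV[R]_n :=
  \col_i ((- (\sum_(j | e i j) (Rline i j)^-1 * (V i 0 - V j 0)) + Iinj i)
          / C i).

Definition frequency_field (m Pm Pgen Pinj : 'I_n -> R) : 'cV[R]_n :=
  \col_i ((Pgen i + Pm i - Pinj i) / m i).

Definition decentralized_injection (Komega KV : 'I_n -> R) (omega_ref : R)
    (Vref : 'I_n -> R) omega V (i : 'I_n) : R :=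
  Komega i * (omega i 0 - omega_ref) + KV i * (Vref i - V i 0).

Definition decentralized_generation (Kdroop : 'I_n -> R) (omega_ref : R)
    omega (i : 'I_n) : R :=
  - (Kdroop i * (omega i 0 - omega_ref)).

Definition distributed_generation (Komega KV Kdroop KdroopI : 'I_n -> R)
    (omega_ref : R) omega eta (i : 'I_n) : R :=
  - (Kdroop i * (omega i 0 - omega_ref))
  - KV i / Komega i * KdroopI i * eta i 0.

Definition integrator_field e (c : 'I_n -> 'I_n -> R) (KdroopI : 'I_n -> R)
    (omega_ref : R) omega eta : 'cV[R]_n :=
  \col_i (KdroopI i * (omega i 0 - omega_ref)
          - \sum_(j | e i j) c i j * (eta i 0 - eta j 0)).

(* State (omega, V).  The injected current is Pinj / Vnom, i.e. the relation
   Vnom * Iinj = Pinj solved for Iinj. *)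
Definition closed_loop_decentralized eR Rline (C m Pm : 'I_n -> R) (Vnom : R)
    (Komega KV Kdroop : 'I_n -> R) (omega_ref : R) (Vref : 'I_n -> R)
    (x : 'cV[R]_n * 'cV[R]_n) : 'cV[R]_n * 'cV[R]_n :=
  let: (omega, V) := x in
  let Pinj := decentralized_injection Komega KV omega_ref Vref omega V in
  let Pgen := decentralized_generation Kdroop omega_ref omega in
  (frequency_field m Pm Pgen Pinj,
   voltage_field eR Rline C (fun i => Pinj i / Vnom) V).

(* State (omega, V, eta). *)
Definition closed_loop_distributed eR Rline (C m Pm : 'I_n -> R) (Vnom : R)
    (Komega KV Kdroop KdroopI : 'I_n -> R) (omega_ref : R) (Vref : 'I_n -> R)
    eeta ceta
    (x : 'cV[R]_n * 'cV[R]_n * 'cV[R]_n) : 'cV[R]_n * 'cV[R]_n * 'cV[R]_n :=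
  let: (omega, V, eta) := x in
  let Pinj := decentralized_injection Komega KV omega_ref Vref omega V in
  let Pgen :=
    distributed_generation Komega KV Kdroop KdroopI omega_ref omega eta in
  (frequency_field m Pm Pgen Pinj,
   voltage_field eR Rline C (fun i => Pinj i / Vnom) V,
   integrator_field eeta ceta KdroopI omega_ref omega eta).

End Dynamics.

(* Main.v *)
From HB Require Import structures.
Require Import Defs.
From mathcomp Require Import ring lra.

(** Both closed loops are affine, so it suffices to find a positive definite
    quadratic form [W] with polar form [B] such that, for some [k > 0],
    [B (y - z) (f y - f z) <= - k * W (y - z)]: then [f] is injective, hence has
    a zero, and [W] decays exponentially towards it along every solution.
    Writing [w], [v], [h] for the deviations of [omega], [V], [eta], the energy
    [sum_i (Komega_i / KV_i * m_i * w_i^2 + Vnom * C_i * v_i^2 + h_i^2)]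
    dissipates [w] and [v], and only the disagreement of [h].  Rather than
    invoking LaSalle's principle, the cross term [2 * eps * m_i * w_i * h_i] is
    added: since [w_i] is driven by [- h_i], it makes the dissipation strict for
    small [eps].  Its Laplacian part [eps * m_i * w_i * (L h)_i] is absorbed by
    the energy [h^T L h] of the communication graph, which leaves one quadratic
    form in three variables per node. *)

Set Implicit Arguments.
Unset Strict Implicit.
Unset Printing Implicit Defensive.

Local Open Scope classical_set_scope.
Local Open Scope ring_scope.

(** * Quadratic Lyapunov functions for contracting vector fields *)

Section ContractionForm.
Context {R : realType} {X : normedModType R}.
Implicit Types (p q : X -> R) (B : X -> X -> R) (f : X -> X).

Definition continuous_linear_form p : Prop :=
  continuous p /\ forall a u v, p (a *: u + v) = a * p u + p v.

Lemma is_derive_linear_form p (x : R -> X) (t : R) (dx : X) :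
  continuous_linear_form p -> is_derive t 1 x dx ->
  is_derive t 1 (p \o x) (p dx).
Proof.
move=> [cp lp] [dvx <-].
have pZ a u : p (a *: u) = a * p u.
  have p0 : p 0 = 0 by have := lp 1 0 0; rewrite scaler0 addr0; lra.
  by rewrite -[_ *: _]addr0 lp p0 addr0.
have pB u v : p (u - v) = p u - p v.
  by rewrite addrC -scaleN1r lp mulN1r addrC.
have lim : (h^-1 *: ((p \o x) (h *: 1 + t) - (p \o x) t)) @[h --> 0^'] -->
    p ('D_1 x t).
  rewrite [X in X @ _ --> _](_ : _ =
      p \o (fun h => h^-1 *: (x (h *: 1 + t) - x t))).
    by apply: cvg_comp; [exact: dvx|exact: cp].
  by apply/funext => h /=; rewrite pZ pB.
split; first by apply/cvg_ex; exists (p ('D_1 x t)).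
exact: cvg_lim.
Qed.

(* [B] is the polar form of the quadratic form [z |-> B z z]; only the two
   properties of such forms used in Lyapunov arguments are recorded. *)
Definition polar_form B : Prop :=
  continuous (fun z => B z z) /\
  forall (x : R -> X) (t : R) (dx : X), is_derive t 1 x dx ->
    is_derive t 1 (fun s => B (x s) (x s)) (2 * B (x t) dx).

Lemma polar_form_prod p q :
  continuous_linear_form p -> continuous_linear_form q ->
  polar_form (fun y z => p y * q z + q y * p z).
Proof.
move=> hp hq; split.
  move=> z; apply: cvgD; apply: cvgM;
    by [apply: (proj1 hp)|apply: (proj1 hq)].
move=> x t dx hx.
have dp := is_derive_linear_form hp hx.
have dq := is_derive_linear_form hq hx.
apply: (is_derive_eq (is_deriveD (is_deriveM dp dq) (is_deriveM dq dp))).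
by rewrite /= /GRing.scale /=; ring.
Qed.

Lemma polar_formD B1 B2 : polar_form B1 -> polar_form B2 ->
  polar_form (fun y z => B1 y z + B2 y z).
Proof.
move=> [c1 d1] [c2 d2]; split.
  by move=> z; apply: cvgD; [apply: c1|apply: c2].
move=> x t dx hx; rewrite mulrDr.
exact: (is_deriveD (d1 _ _ _ hx) (d2 _ _ _ hx)).
Qed.

Lemma polar_formZ (a : R) B : polar_form B ->
  polar_form (fun y z => a * B y z).
Proof.
move=> [cB dB]; split.
  by move=> z; apply: cvgM; [apply: cvg_cst|apply: cB].
move=> x t dx hx.
apply: (is_derive_eq (is_deriveZ a (dB _ _ _ hx))).
by rewrite /GRing.scale /=; ring.
Qed.

Lemma polar_form_sqr p : continuous_linear_form p ->
  polar_form (fun y z => p y * p z).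
Proof.
move=> hp; have := polar_formZ 2^-1 (polar_form_prod hp hp).
by congr polar_form; apply/funext => y; apply/funext => z; field.
Qed.

Lemma polar_form_sum n (B : 'I_n -> X -> X -> R) :
  (forall i, polar_form (B i)) -> polar_form (fun y z => \sum_i B i y z).
Proof.
move=> hB; split.
  apply: continuous_big => [|i _]; first exact: add_continuous.
  exact: (proj1 (hB i)).
move=> x t dx hx.
have := is_derive_sum (fun i => proj2 (hB i) _ _ _ hx).
by rewrite -mulr_sumr (_ : (\sum_i _) = (fun s => \sum_i B i (x s) (x s)))//;
   apply/funext => s; rewrite fct_sumE.
Qed.

(** Bilinearity is not part of [polar_form]; this instance of it follows from the derivative rule
    along the constant curve [y], whose velocity is 0. *)
Lemma polar_formr0 B y : polar_form B -> B y 0 = 0.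
Proof.
move=> [_ dB]; have [_] := dB _ _ _ (is_derive_cst y (0 : R) 1).
by rewrite /= derive_cst => /esym/eqP; rewrite mulf_eq0 pnatr_eq0 => /eqP.
Qed.

Section Contraction.
Variables (B : X -> X -> R) (c k : R) (f : X -> X).
Hypotheses (k_gt0 : 0 < k) (B_polar : polar_form B).
Hypothesis B_coercive : forall z, `|z| ^+ 2 <= c * B z z.
Hypothesis c_gt0 : 0 < c.
Hypothesis f_contracting : forall y z,
  B (y - z) (f y - f z) <= - k * B (y - z) (y - z).

Let B_ge0 z : 0 <= B z z.
Proof.
by rewrite -(pmulr_rge0 _ c_gt0) (le_trans _ (B_coercive z))// sqr_ge0.
Qed.

(** With [f y = f z] the contraction bound reads [0 <= - k * B d d] for [d = y - z], so [B d d]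
    vanishes and coercivity gives [d = 0]. *)
Lemma contracting_injective : injective f.
Proof.
move=> y z fyz; have := f_contracting y z.
rewrite fyz subrr (polar_formr0 _ B_polar) mulNr oppr_ge0 pmulr_rle0// => Bd.
have {}Bd : B (y - z) (y - z) = 0 by apply/eqP; rewrite eq_le Bd B_ge0.
have := B_coercive (y - z).
rewrite Bd mulr0 exprn_even_le0//= normr_eq0 subr_eq0.
by move=> /eqP.
Qed.

(** A Gronwall argument: the weight [expR (2 * k * s)] turns the differential inequality for [B]
    along [x] into monotonicity of the product [g]. *)
Lemma contracting_decay xe (x : R -> X) (t : R) :
  is_equilibrium f xe -> is_solution f x -> 0 <= t ->
  expR (2 * k * t) * B (x t - xe) (x t - xe) <= B (x 0 - xe) (x 0 - xe).
Proof.
move=> fxe [cx dx] t_ge0.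
pose g s := expR (2 * k * s) * B (x s - xe) (x s - xe).
have dE (s : R) : is_derive s 1 (fun s : R => expR (2 * k * s))
    (2 * k * expR (2 * k * s)).
  apply: (is_derive_eq (is_derive1_comp (is_derive_expR (2 * k * s))
    (is_deriveZ (2 * k) (is_derive_id s 1)))).
  by rewrite /GRing.scale /= mulr1 mulrC.
have dg (s : R) : 0 < s -> is_derive s 1 g
   (2 * expR (2 * k * s) *
     (B (x s - xe) (f (x s)) + k * B (x s - xe) (x s - xe))).
  move=> s0.
  have dxe : is_derive s 1 (fun s => x s - xe) (f (x s)).
    by apply: (is_derive_eq (is_deriveB (dx _ s0) (is_derive_cst xe s 1)));
      rewrite subr0.
  apply: (is_derive_eq (is_deriveM (dE s) (proj2 B_polar _ _ _ dxe))).
  by rewrite /GRing.scale /=; ring.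
have : g t <= g 0.
  (* This monotonicity criterion asks for a derivative on the open half-line and continuity on the
     closed one, exactly what [is_solution] provides. *)
  apply: (@ler0_derive1_nincry _ g 0) => //.
  - by move=> s; rewrite in_itv /= andbT => /dg [].
  - move=> s; rewrite in_itv /= andbT => s0.
    rewrite derive1E (@derive_val _ _ _ _ _ _ _ (dg _ s0)).
    rewrite pmulr_rle0 ?mulr_gt0 ?expR_gt0//.
    have := f_contracting (x s) xe; rewrite fxe subr0 mulNr; lra.
  - have cE : {within `[0, +oo[, continuous (fun s : R => expR (2 * k * s))}.
      apply: continuous_subspaceT => u.
      by apply: differentiable_continuous; apply/derivable1_diffP; case: (dE u).
    have cB : continuous (fun z => B (z - xe) (z - xe)).
      move=> z; apply: (@continuous_comp _ _ _ (fun z => z - xe)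
        (fun z => B z z)); last exact: (proj1 B_polar).
      by apply: cvgB; [apply: cvg_id|apply: cvg_cst].
    have cBx : {within `[0, +oo[,
        continuous ((fun z => B (z - xe) (z - xe)) \o x)}.
      by move=> s; exact: (continuous_comp (cx s) (cB (x s))).
    by move=> s; exact: (continuousM (cE s) (cBx s)).
by rewrite /g mulr0 expR0 mul1r.
Qed.

Lemma contracting_gas xe : is_equilibrium f xe ->
  globally_asymptotically_stable f xe.
Proof.
move=> fxe; split.
  move=> eps eps0.
  have B00 : B 0 0 = 0 by exact: polar_formr0.
  have /cvgr_dist_lt : B z z @[z --> 0] --> (0 : R).
    by rewrite -[X in _ --> X]B00; apply: (proj1 B_polar).
  (* Below this level of [B], coercivity forces the norm below [eps]; since [B] does not grow along
     solutions, the sublevel set is never left. *)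
  move=> /(_ (eps ^+ 2 / c)); rewrite divr_gt0 ?exprn_gt0// => /(_ isT).
  move=> /nbhs_normP [d /= d0 hd]; exists d => // x solx x0 t t0.
  have := hd (x 0 - xe); rewrite /ball_ /= sub0r normrN => /(_ x0).
  rewrite sub0r normrN ger0_norm // ltr_pdivlMr // => hB.
  rewrite -(ltr_pXn2r (n := 2)) ?nnegrE ?normr_ge0 ?ltW//.
  apply: (le_lt_trans (B_coercive _)); apply: le_lt_trans hB.
  rewrite mulrC ler_pM2r //; apply: le_trans (contracting_decay fxe solx t0).
  rewrite ler_peMl // -expR0 ler_expR !mulr_ge0 // ltW //.
move=> x solx.
apply/cvgrPdist_lt => eps eps0.
(* The crude bound [2 * k * t <= expR (2 * k * t)] already gives a squared distance of at most
   [M / t], enough for convergence. *)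
pose M := c * B (x 0 - xe) (x 0 - xe) / (2 * k).
have M_ge0 : 0 <= M by rewrite /M divr_ge0 ?mulr_ge0 // ltW.
near=> t.
have t_gt0 : 0 < t by near: t; apply: nbhs_pinfty_gt; rewrite num_real.
have t_gtM : M / eps ^+ 2 < t.
  by near: t; apply: nbhs_pinfty_gt; rewrite num_real.
rewrite distrC -(ltr_pXn2r (n := 2)) ?nnegrE ?normr_ge0 ?ltW//.
apply: (le_lt_trans (B_coercive _)).
have H := contracting_decay fxe solx (ltW t_gt0).
have tB : 2 * k * t * B (x t - xe) (x t - xe) <= B (x 0 - xe) (x 0 - xe).
  apply: le_trans H; rewrite ler_wpM2r //.
  by apply: le_trans (expR_ge1Dx _); rewrite lerDr.
have k2 : 0 < 2 * k by rewrite mulr_gt0.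
apply: (@le_lt_trans _ _ (M / t)).
  rewrite /M ler_pdivlMr // ler_pdivlMr // -!mulrA ler_pM2l //.
  move: tB; rewrite (_ : B _ _ * _ = 2 * k * t * B (x t - xe) (x t - xe)) //.
  by ring.
by rewrite ltr_pdivrMr // mulrC -ltr_pdivrMr // exprn_gt0.
Unshelve. all: by end_near.
Qed.

End Contraction.
End ContractionForm.

(** * Zeros of affine maps, and thresholds uniform over the nodes *)

(** The linear part [g] inherits injectivity from [f]; in finite dimension it is then invertible,
    and [g z = - f 0] can be solved. This gives the existence of equilibria. *)
Lemma affine_injective_zero (K : fieldType) (X : vectType K) (f g : X -> X) :
  linear g -> (forall y z, f y - f z = g (y - z)) -> injective f ->
  exists z, f z = 0.
Proof.
move=> g_lin fg f_inj.
pose g' : {linear X -> X} := HB.pack g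
  (GRing.isLinear.Build _ _ _ _ _ g_lin).
have ker0 : lker (linfun g') == 0%VS.
  apply/lker0P => y z; rewrite !lfunE /= => gyz; apply: f_inj.
  apply/(addIr (- f 0)); rewrite !fg !subr0.
  exact: gyz.
exists ((linfun g')^-1%VF (- f 0)).
have := lker0_lfunVK ker0 (- f 0); rewrite lfunE /= => gz.
by apply: (addIr (- f 0)); rewrite fg subr0 gz add0r.
Qed.

(** The minimum of the finitely many thresholds works, built by induction so that [n = 0] is covered
    (with the arbitrary value 1). *)
Lemma uniform_pos_bound (R : realFieldType) n (P : 'I_n -> R -> Prop) :
  (forall i (k k' : R), 0 < k' -> k' <= k -> P i k -> P i k') ->
  (forall i, exists2 k, 0 < k & P i k) -> exists2 k, 0 < k & forall i, P i k.
Proof.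
elim: n P => [|n IHn] P P_anti P_ex; first by exists 1 => // -[].
have [k1 k1_gt0 Pk1] := IHn (fun i => P (lift ord0 i))
  (fun i => P_anti _) (fun i => P_ex _).
have [k0 k0_gt0 Pk0] := P_ex ord0.
have k_gt0 : 0 < Num.min k0 k1 by rewrite lt_min k0_gt0.
exists (Num.min k0 k1) => // i; case: (unliftP ord0 i) => [j|] ->.
  by apply: P_anti (Pk1 j) => //; rewrite ge_min lexx orbT.
by apply: P_anti Pk0 => //; rewrite ge_min lexx.
Qed.

(** * Weighted graph Laplacians and their energy *)

Section Laplacian.
Context {R : realFieldType} {n : nat}.
Variables (e : rel 'I_n) (c : 'I_n -> 'I_n -> R).

Definition laplacian_action (v : 'I_n -> R) (i : 'I_n) : R :=
  \sum_(j | e i j) c i j * (v i - v j).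

(** The factor one half compensates for every undirected edge being met in both orientations. *)
Definition dirichlet_energy (v : 'I_n -> R) : R :=
  2^-1 * \sum_i \sum_(j | e i j) c i j * (v i - v j) ^+ 2.

Lemma laplacian_actionP (a : R) (v v' : 'I_n -> R) i :
  laplacian_action (fun j => a * v j + v' j) i =
  a * laplacian_action v i + laplacian_action v' i.
Proof.
rewrite /laplacian_action mulr_sumr -big_split /=.
by apply: eq_bigr => j _; ring.
Qed.

Lemma laplacian_actionB (v v' : 'I_n -> R) i :
  laplacian_action (fun j => v j - v' j) i =
  laplacian_action v i - laplacian_action v' i.
Proof.
by rewrite /laplacian_action -sumrB; apply: eq_bigr => j _; ring.
Qed.

Hypothesis e_sym : symmetric e.
Hypothesis c_pos : forall i j, e i j -> 0 < c i j /\ c i j = c j i.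

(** Summation by parts: exchanging [i] and [j] gives a second expression [S2] of the sum, and adding
    it to [S1] produces the squares of the differences. *)
Lemma laplacian_energy (v : 'I_n -> R) :
  \sum_i v i * laplacian_action v i = dirichlet_energy v.
Proof.
pose S := \sum_i v i * laplacian_action v i.
suff SS : S + S = 2 * dirichlet_energy v.
  by rewrite -/S; lra.
have S1 : S = \sum_i \sum_(j | e i j) c i j * (v i - v j) * v i.
  by apply: eq_bigr => i _; rewrite mulr_sumr; apply: eq_bigr => j _; ring.
have S2 : S = \sum_i \sum_(j | e i j) - (c i j * (v i - v j) * v j).
  rewrite S1 (exchange_big_dep xpredT) //=; apply: eq_bigr => i _.
  rewrite (eq_bigl _ _ (e_sym^~ i)) //; apply: eq_bigr => j eij.
  by have [_ ->] := c_pos eij; ring.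
rewrite {1}S1 S2 -big_split /dirichlet_energy mulrA divff ?pnatr_eq0 // mul1r.
apply: eq_bigr => i _; rewrite -big_split; apply: eq_bigr => j _ /=; ring.
Qed.

Lemma dirichlet_energy_ge0 (v : 'I_n -> R) : 0 <= dirichlet_energy v.
Proof.
rewrite mulr_ge0 ?invr_ge0 // sumr_ge0 // => i _; rewrite sumr_ge0 // => j eij.
by rewrite mulr_ge0 ?sqr_ge0 // ltW //; have [] := c_pos eij.
Qed.

(** Young's inequality edge by edge, from the square of [u i + (v i - v j)]. The price is a diagonal
    term in [u] weighted by the node degrees. *)
Lemma laplacian_cross_term (u v : 'I_n -> R) :
  - \sum_i u i * laplacian_action v i - dirichlet_energy v <=
  2^-1 * \sum_i (\sum_(j | e i j) c i j) * u i ^+ 2.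
Proof.
rewrite lerBlDr /dirichlet_energy -mulrDr -big_split /= mulr_sumr -sumrN.
apply: ler_sum => i _; rewrite mulr_suml -big_split /= !mulr_sumr -sumrN.
apply: ler_sum => j eij; have [cij _] := c_pos eij.
suff : 0 <= 2^-1 * c i j * (u i + (v i - v j)) ^+ 2 by lra.
by rewrite mulr_ge0 ?sqr_ge0 // mulr_ge0 ?invr_ge0 // ltW.
Qed.

End Laplacian.

(** * Quadratic inequalities at a single node *)

(* With u = q w - r v, the form p w^2 + u^2 / r controls v through
   r v = q w - u. *)
Lemma node_dissipation (R : realFieldType) (p q r : R) :
  0 < p -> 0 < q -> 0 < r ->
  exists2 d, 0 < d & forall w v,
    d * (w ^+ 2 + v ^+ 2) <= p * w ^+ 2 + (q * w - r * v) ^+ 2 / r.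
Proof.
move=> p0 q0 r0; pose s := q / r.
have s0 : 0 < s by rewrite divr_gt0.
(* With [v = s * w - y] one has [v ^+ 2 <= 2 * s ^+ 2 * w ^+ 2 + 2 * y ^+ 2]; the two arguments of
   the minimum bound the resulting coefficients of [w ^+ 2] and [y ^+ 2]. *)
pose d := Num.min (p / (1 + 2 * s ^+ 2)) (r / 2).
have s2 : 0 < 1 + 2 * s ^+ 2 by rewrite ltr_wpDr // mulr_ge0 // sqr_ge0.
have d1 : d * (1 + 2 * s ^+ 2) <= p by rewrite -ler_pdivlMr // /d ge_min lexx.
have d2 : d <= r / 2 by rewrite /d ge_min lexx orbT.
have d0 : 0 < d by rewrite /d lt_min !divr_gt0.
exists d => // w v; pose y := s * w - v.
have -> : (q * w - r * v) ^+ 2 / r = r * y ^+ 2.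
  by rewrite /y /s; field; rewrite gt_eqF.
have -> : v = s * w - y by rewrite /y; ring.
have h1 : 0 <= (p - d * (1 + 2 * s ^+ 2)) * w ^+ 2.
  by rewrite mulr_ge0 ?sqr_ge0 // subr_ge0.
have h2 : 0 <= (r - 2 * d) * y ^+ 2.
  by rewrite mulr_ge0 ?sqr_ge0 // subr_ge0; lra.
have h3 : 0 <= d * (s * w + y) ^+ 2 by rewrite mulr_ge0 ?sqr_ge0 // ltW.
lra.
Qed.

(** The bracket supplies the missing damping [g * h ^+ 2]. Its other terms cost at most half of that
    damping and [eps * L * (w ^+ 2 + v ^+ 2)], which for small [eps] is at most half of the damping
    from [node_dissipation]. *)
Lemma node_dissipation_integral (R : realFieldType) (p q r g a b M : R) :
  0 < p -> 0 < q -> 0 < r -> 0 < g -> 0 <= M ->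
  exists2 eps0, 0 < eps0 & forall eps, 0 < eps -> eps <= eps0 ->
  exists2 k, 0 < k & forall w v h,
    k * (w ^+ 2 + v ^+ 2 + h ^+ 2) <=
    p * w ^+ 2 + (q * w - r * v) ^+ 2 / r
    + eps * (g * h ^+ 2 + h * (a * w + b * v) - M * w ^+ 2).
Proof.
move=> p0 q0 r0 g0 M0; have [d d0 hd] := node_dissipation p0 q0 r0.
pose L := M + (a ^+ 2 + b ^+ 2) / g.
have L0 : 0 <= L.
  by rewrite addr_ge0 // divr_ge0 ?(ltW g0) // addr_ge0 // sqr_ge0.
(* Ensures [eps * L <= d / 2]; the added 1 keeps the denominator positive when [L = 0]. *)
exists (d / (2 * L + 1)).
  by rewrite divr_gt0 // ltr_wpDl // mulr_ge0.
move=> eps e0; rewrite ler_pdivlMr; last by rewrite ltr_wpDl // mulr_ge0.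
move=> heps; exists (Num.min (d / 2) (eps * g / 2)).
  by rewrite lt_min !divr_gt0 // mulr_gt0.
move=> w v h; set k := Num.min _ _.
have k1 : k <= d / 2 by rewrite /k ge_min lexx.
have k2 : k <= eps * g / 2 by rewrite /k ge_min lexx orbT.
have young : - (h * (a * w + b * v)) <=
    g / 2 * h ^+ 2 + (a ^+ 2 + b ^+ 2) / g * (w ^+ 2 + v ^+ 2).
  (* Completing the square in [h], then Lagrange's identity [(a * w + b * v) ^+ 2 + (a * v - b * w)
     ^+ 2 = (a ^+ 2 + b ^+ 2) * (w ^+ 2 + v ^+ 2)]. *)
  have : 0 <= g / 2 * (h + (a * w + b * v) / g) ^+ 2 +
      ((a * w + b * v) ^+ 2 / 2 + (a * v - b * w) ^+ 2) / g.
    by rewrite !(sqr_ge0, ler0n, invr_ge0, ltW g0, addr_ge0, mulr_ge0).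
  rewrite -[X in _ -> is_true X]subr_ge0; congr (0 <= _); field.
  exact: lt0r_neq0.
have Mv : 0 <= M * v ^+ 2 by rewrite mulr_ge0 ?sqr_ge0.
have e1 : eps * (- (h * (a * w + b * v)) + M * w ^+ 2) <=
    eps * (g / 2 * h ^+ 2) + eps * L * (w ^+ 2 + v ^+ 2).
  rewrite -[_ * L * _]mulrA -mulrDr; apply: ler_wpM2l; first exact: ltW.
  by rewrite /L; lra.
have e2 : eps * L * (w ^+ 2 + v ^+ 2) <= d / 2 * (w ^+ 2 + v ^+ 2).
  by rewrite ler_wpM2r ?addr_ge0 ?sqr_ge0 //; lra.
have e3 : k * (w ^+ 2 + v ^+ 2) <= d / 2 * (w ^+ 2 + v ^+ 2).
  by rewrite ler_wpM2r ?addr_ge0 ?sqr_ge0.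
have e4 : k * h ^+ 2 <= eps * g / 2 * h ^+ 2 by rewrite ler_wpM2r ?sqr_ge0.
have := hd w v; lra.
Qed.

(** For small [eps] the cross term leaves the energy equivalent to the sum of squares. Both bounds
    share one [k], which may depend on [eps]. *)
Lemma node_storage (R : realFieldType) (p q m : R) :
  0 < p -> 0 < q -> 0 < m ->
  exists2 eps0, 0 < eps0 & forall eps, 0 < eps -> eps <= eps0 ->
  exists2 k, 0 < k & forall w v h,
    let W := p * w ^+ 2 + q * v ^+ 2 + h ^+ 2 + eps * m * (w * h + h * w) in
    k * (w ^+ 2 + v ^+ 2 + h ^+ 2) <= W /\
    k * W <= w ^+ 2 + v ^+ 2 + h ^+ 2.
Proof.
move=> p0 q0 m0.
exists (Num.min 1 (p / 4) / m).
  by rewrite divr_gt0 // lt_min ltr01 divr_gt0.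
move=> eps e0; rewrite ler_pdivlMr // le_min => /andP[e1 e2].
set u := eps * m in e1 e2 *; have u0 : 0 < u by rewrite mulr_gt0.
have uu : u ^+ 2 <= p / 4.
  by apply: le_trans e2; rewrite expr2 ger_pMr.
(* [k0] is the least coefficient left after the cross term has taken [p / 2] from [w ^+ 2] and one
   half from [h ^+ 2]; [k1] inverts the upper bound, where the cross term is at most
   [w ^+ 2 + h ^+ 2]. *)
pose k0 := Num.min (Num.min (p / 2) q) (1 / 2); pose k1 := (p + q + 2)^-1.
have s0 : 0 < p + q + 2 by rewrite !addr_gt0.
exists (Num.min k0 k1).
  by rewrite !lt_min q0 !divr_gt0 // invr_gt0 s0.
move=> w v h /=; set k := Num.min _ _.
have [w2 v2 h2] : [/\ 0 <= w ^+ 2, 0 <= v ^+ 2 & 0 <= h ^+ 2].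
  by rewrite !sqr_ge0.
have cross : - (u * w) ^+ 2 * 2 - h ^+ 2 / 2 <= u * (w * h + h * w).
  by have := sqr_ge0 (2 * (u * w) + h); lra.
have uw : (u * w) ^+ 2 <= p / 4 * w ^+ 2.
  by rewrite exprMn ler_wpM2r.
have kp : k <= p / 2 by rewrite /k /k0 !ge_min lexx.
have kq : k <= q by rewrite /k /k0 !ge_min lexx orbT.
have kh : k <= 1 / 2 by rewrite /k /k0 !ge_min lexx orbT.
have kk : k <= k1 by rewrite /k ge_min lexx orbT.
have lower : k * (w ^+ 2 + v ^+ 2 + h ^+ 2) <=
    p * w ^+ 2 + q * v ^+ 2 + h ^+ 2 + u * (w * h + h * w).
  have := ler_wpM2r w2 kp; have := ler_wpM2r v2 kq; have := ler_wpM2r h2 kh.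
  lra.
have k_ge0 : 0 < k by rewrite !lt_min q0 !divr_gt0 // invr_gt0 s0.
split=> //.
have upper : p * w ^+ 2 + q * v ^+ 2 + h ^+ 2 + u * (w * h + h * w) <=
    (p + q + 2) * (w ^+ 2 + v ^+ 2 + h ^+ 2).
  have : u * (w * h + h * w) <= w ^+ 2 + h ^+ 2.
    have [] : 0 <= u * (w - h) ^+ 2 /\ 0 <= (1 - u) * (w ^+ 2 + h ^+ 2).
      by split; apply: mulr_ge0;
        rewrite ?sqr_ge0 ?subr_ge0 ?(ltW u0) // addr_ge0.
    lra.
  have := mulr_ge0 (ltW p0) v2; have := mulr_ge0 (ltW p0) h2.
  have := mulr_ge0 (ltW q0) w2; have := mulr_ge0 (ltW q0) h2.
  lra.
apply: (le_trans (ler_wpM2l (ltW k_ge0) upper)).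
rewrite mulrA ler_piMl ?addr_ge0 //.
by rewrite -ler_pdivlMr // mul1r.
Qed.

(** * Coordinate forms and norms on the state space *)

Lemma continuous_linear_form_coord (R : realType) n (i : 'I_n) :
  continuous_linear_form (fun v : 'cV[R]_n => v i 0).
Proof. by split=> [|a u v]; [exact: coord_continuous|rewrite !mxE]. Qed.

Lemma continuous_linear_form_fst (R : realType) (X Y : normedModType R)
    (p : X -> R) : continuous_linear_form p ->
  continuous_linear_form (fun z : X * Y => p z.1).
Proof.
move=> [cp lp]; split=> [z|a u v]; last exact: lp.
by apply: (@continuous_comp _ _ _ fst p); [exact: cvg_fst|exact: cp].
Qed.

Lemma continuous_linear_form_snd (R : realType) (X Y : normedModType R)
    (p : Y -> R) : continuous_linear_form p ->
  continuous_linear_form (fun z : X * Y => p z.2).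
Proof.
move=> [cp lp]; split=> [z|a u v]; last exact: lp.
by apply: (@continuous_comp _ _ _ snd p); [exact: cvg_snd|exact: cp].
Qed.

Arguments continuous_linear_form_fst {R X} Y {p}.
Arguments continuous_linear_form_snd {R} X {Y p}.

(** The norm here is the maximum norm, so the Euclidean norm dominates it. *)
Lemma cV_norm_sqr_le (R : realType) n (v : 'cV[R]_n) :
  `|v| ^+ 2 <= \sum_i v i 0 ^+ 2.
Proof.
have S0 : 0 <= \sum_i v i 0 ^+ 2 by rewrite sumr_ge0 // => i _; rewrite sqr_ge0.
rewrite -[leRHS]sqr_sqrtr // ler_pXn2r ?nnegrE ?sqrtr_ge0 //.
rewrite [`|v|]mx_normrE; apply: bigmax_le => [|[i j] _ /=].
  exact: sqrtr_ge0.
rewrite ord1 -sqrtr_sqr ler_wsqrtr // (bigD1 i) //= lerDl.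
by rewrite sumr_ge0 // => l _; rewrite sqr_ge0.
Qed.

Lemma prod_norm_sqr_le (R : realType) (X Y : normedModType R) (z : X * Y) :
  `|z| ^+ 2 <= `|z.1| ^+ 2 + `|z.2| ^+ 2.
Proof.
by rewrite prod_normE /Num.max; case: ifP => _; rewrite ?lerDl ?lerDr sqr_ge0.
Qed.

(** * From single nodes to the whole network *)

(** [N] is the squared norm of a node state, [W] its energy and [D] its dissipation. With one [k]
    for all nodes, [D >= k * N >= k ^+ 2 * W], so [k ^+ 2] is the contraction rate. *)
Lemma nodewise_contraction (R : realFieldType) n (T : Type)
    (N W D : 'I_n -> T -> R) :
  (forall i x, 0 <= N i x) ->
  (forall i, exists2 k, 0 < k &
    forall x, k * N i x <= W i x /\ k * W i x <= N i x) ->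
  (forall i, exists2 k, 0 < k & forall x, k * N i x <= D i x) ->
  exists2 k, 0 < k & forall x : 'I_n -> T,
    k * \sum_i N i (x i) <= \sum_i W i (x i) /\
    k ^+ 2 * \sum_i W i (x i) <= \sum_i D i (x i).
Proof.
move=> N_ge0 NW ND.
have W_ge0 i x : 0 <= W i x.
  have [k k0 /(_ x)[kN _]] := NW i.
  by apply: le_trans kN; rewrite mulr_ge0 // ltW.
pose P i k := forall x, [/\ k * N i x <= W i x, k * W i x <= N i x &
  k * N i x <= D i x].
have P_anti i (k k' : R) : 0 < k' -> k' <= k -> P i k -> P i k'.
  move=> _ kk' Pk x; have [k1 k2 k3] := Pk x.
  by split; [apply: le_trans k1|apply: le_trans k2|apply: le_trans k3];
    rewrite ler_wpM2r.
have [|k k0 Pk] := uniform_pos_bound P_anti.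
  move=> i; have [k1 k10 NWk] := NW i; have [k2 k20 NDk] := ND i.
  exists (Num.min k1 k2); first by rewrite lt_min k10.
  have [le1 le2] : Num.min k1 k2 <= k1 /\ Num.min k1 k2 <= k2.
    by rewrite !ge_min !lexx orbT.
  move=> x; have [h1 h2] := NWk x; have h3 := NDk x.
  by split; [apply: le_trans h1|apply: le_trans h2|apply: le_trans h3];
    rewrite ler_wpM2r.
exists k => // x; rewrite !mulr_sumr; split; apply: ler_sum => i _;
  have [k1 k2 k3] := Pk i (x i) => //.
by apply: le_trans k3; rewrite expr2 -mulrA ler_pM2l.
Qed.

(** * The closed loops as affine vector fields *)

Section ClosedLoops.
Context {R : realType} {n : nat}.
Variables (eR eeta : rel 'I_n) (Rline ceta : 'I_n -> 'I_n -> R).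
Variables (C m Pm Komega KV Kdroop KdroopI Vref : 'I_n -> R).
Variables (Vnom omega_ref : R).

Let LR := laplacian_action eR (fun i j => (Rline i j)^-1).
Let Leta := laplacian_action eeta ceta.

Let fa := closed_loop_decentralized eR Rline C m Pm Vnom
            Komega KV Kdroop omega_ref Vref.
(** Zeroing the constant inputs and references leaves the linear part of [fa], which governs
    deviations. *)
Let fa0 := closed_loop_decentralized eR Rline C m (fun=> 0) Vnom
            Komega KV Kdroop 0 (fun=> 0).
Let fb := closed_loop_distributed eR Rline C m Pm Vnom
            Komega KV Kdroop KdroopI omega_ref Vref eeta ceta.
Let fb0 := closed_loop_distributed eR Rline C m (fun=> 0) Vnom
            Komega KV Kdroop KdroopI 0 (fun=> 0) eeta ceta.

Lemma voltage_fieldE (Iinj : 'I_n -> R) (V : 'cV[R]_n) i :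
  voltage_field eR Rline C Iinj V i 0 =
  (- LR (fun j => V j 0) i + Iinj i) / C i.
Proof. by rewrite mxE. Qed.

Lemma integrator_fieldE (r : R) (omega eta : 'cV[R]_n) i :
  integrator_field eeta ceta KdroopI r omega eta i 0 =
  KdroopI i * (omega i 0 - r) - Leta (fun j => eta j 0) i.
Proof. by rewrite mxE. Qed.

Lemma coordB (u v : 'cV[R]_n) :
  (fun j => (u - v) j 0) = (fun j => u j 0 - v j 0).
Proof. by apply/funext => j; rewrite !mxE. Qed.

Lemma coordP (a : R) (u v : 'cV[R]_n) :
  (fun j => (a *: u + v) j 0) = (fun j => a * u j 0 + v j 0).
Proof. by apply/funext => j; rewrite !mxE. Qed.

Lemma closed_loop_decentralizedB y z : fa y - fa z = fa0 (y - z).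
Proof.
case: y z => [w v] [w' v']; congr pair; apply/colP => i.
  rewrite !mxE /decentralized_injection /decentralized_generation !mxE; ring.
rewrite mxE [X in _ + X]mxE !voltage_fieldE coordB /LR laplacian_actionB.
rewrite /decentralized_injection !mxE; ring.
Qed.

Lemma closed_loop_decentralized_linear : linear fa0.
Proof.
move=> a [w v] [w' v'].
rewrite (_ : a *: (w, v) + (w', v') = (a *: w + w', a *: v + v')) //.
congr pair; apply/colP => i; rewrite [RHS]mxE [X in _ = X + _]mxE.
  rewrite !mxE /decentralized_injection /decentralized_generation !mxE; ring.
rewrite !voltage_fieldE coordP /LR laplacian_actionP.
rewrite /decentralized_injection !mxE; ring.
Qed.

Lemma closed_loop_distributedB y z : fb y - fb z = fb0 (y - z).
Proof.
case: y z => [[w v] h] [[w' v'] h'].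
congr (_, _, _); apply/colP => i; rewrite [LHS]mxE [X in _ + X = _]mxE.
- rewrite !mxE /decentralized_injection /distributed_generation !mxE; ring.
- rewrite !voltage_fieldE coordB /LR laplacian_actionB.
  rewrite /decentralized_injection !mxE; ring.
- rewrite !integrator_fieldE coordB /Leta laplacian_actionB !mxE; ring.
Qed.

Lemma closed_loop_distributed_linear : linear fb0.
Proof.
move=> a [[w v] h] [[w' v'] h'].
rewrite (_ : a *: (w, v, h) + (w', v', h') =
  (a *: w + w', a *: v + v', a *: h + h')) //.
congr (_, _, _); apply/colP => i; rewrite [RHS]mxE [X in _ = X + _]mxE.
- rewrite !mxE /decentralized_injection /distributed_generation !mxE; ring.
- rewrite !voltage_fieldE coordP /LR laplacian_actionP.
  rewrite /decentralized_injection !mxE; ring.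
- rewrite !integrator_fieldE coordP /Leta laplacian_actionP !mxE; ring.
Qed.

(** * Energy forms and their dissipation *)

Hypotheses (eR_sym : symmetric eR) (eeta_sym : symmetric eeta).
Hypothesis Rline_pos : positive_symmetric_on eR Rline.
Hypothesis ceta_pos : positive_symmetric_on eeta ceta.
Hypotheses (C_gt0 : forall i, 0 < C i) (m_gt0 : forall i, 0 < m i).
Hypotheses (Komega_gt0 : forall i, 0 < Komega i) (KV_gt0 : forall i, 0 < KV i).
Hypothesis Kdroop_gt0 : forall i, 0 < Kdroop i.
Hypothesis KdroopI_gt0 : forall i, 0 < KdroopI i.
Hypothesis Vnom_gt0 : 0 < Vnom.

Let Rinv_pos i j : eR i j ->
  0 < (Rline i j)^-1 /\ (Rline i j)^-1 = (Rline j i)^-1.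
Proof. by move=> /Rline_pos[R0 <-]; rewrite invr_gt0. Qed.

Let gain i : 0 < Komega i / KV i. Proof. exact: divr_gt0. Qed.

(** The weights make the coupling contribute [Komega i * w * v] from both equations, which completes
    the square [(Komega i * w - KV i * v) ^+ 2 / KV i]. *)
Definition form_decentralized (y z : 'cV[R]_n * 'cV[R]_n) : R :=
  \sum_i (Komega i / KV i * m i * (y.1 i 0 * z.1 i 0)
          + Vnom * C i * (y.2 i 0 * z.2 i 0)).

(** Weight 1 on the integrator state cancels its coupling with the frequency: the two contributions
    are [KdroopI i * w * h] with opposite signs. *)
Definition form_distributed (eps : R)
    (y z : 'cV[R]_n * 'cV[R]_n * 'cV[R]_n) : R :=
  \sum_i (Komega i / KV i * m i * (y.1.1 i 0 * z.1.1 i 0)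
          + Vnom * C i * (y.1.2 i 0 * z.1.2 i 0) + y.2 i 0 * z.2 i 0
          + eps * m i * (y.1.1 i 0 * z.2 i 0 + y.2 i 0 * z.1.1 i 0)).

Lemma form_decentralized_polar : polar_form form_decentralized.
Proof.
have w_lin i : continuous_linear_form
    (fun z : 'cV[R]_n * 'cV[R]_n => z.1 i 0).
  exact: (continuous_linear_form_fst 'cV[R]_n
    (continuous_linear_form_coord R i)).
have v_lin i : continuous_linear_form
    (fun z : 'cV[R]_n * 'cV[R]_n => z.2 i 0).
  exact: (continuous_linear_form_snd 'cV[R]_n
    (continuous_linear_form_coord R i)).
apply: polar_form_sum => i.
by apply: polar_formD; apply: polar_formZ;
  [exact: (polar_form_sqr (w_lin i))|exact: (polar_form_sqr (v_lin i))].
Qed.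

Lemma form_distributed_polar eps : polar_form (form_distributed eps).
Proof.
have coord (i : 'I_n) := continuous_linear_form_coord R i.
have w_lin i : continuous_linear_form
    (fun z : 'cV[R]_n * 'cV[R]_n * 'cV[R]_n => z.1.1 i 0).
  exact: (continuous_linear_form_fst 'cV[R]_n
    (continuous_linear_form_fst 'cV[R]_n (coord i))).
have v_lin i : continuous_linear_form
    (fun z : 'cV[R]_n * 'cV[R]_n * 'cV[R]_n => z.1.2 i 0).
  exact: (continuous_linear_form_fst 'cV[R]_n
    (continuous_linear_form_snd 'cV[R]_n (coord i))).
have h_lin i : continuous_linear_form
    (fun z : 'cV[R]_n * 'cV[R]_n * 'cV[R]_n => z.2 i 0).
  exact: (continuous_linear_form_snd ('cV[R]_n * 'cV[R]_n)%type (coord i)).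
apply: polar_form_sum => i; apply: polar_formD; last first.
  by apply: polar_formZ; exact: (polar_form_prod (w_lin i) (h_lin i)).
apply: polar_formD; last exact: (polar_form_sqr (h_lin i)).
by apply: polar_formD; apply: polar_formZ;
  [exact: (polar_form_sqr (w_lin i))|exact: (polar_form_sqr (v_lin i))].
Qed.

Lemma form_decentralized_dissipation (z : 'cV[R]_n * 'cV[R]_n) :
  form_decentralized z (fa0 z) <=
  - \sum_i (Komega i / KV i * Kdroop i * z.1 i 0 ^+ 2
            + (Komega i * z.1 i 0 - KV i * z.2 i 0) ^+ 2 / KV i).
Proof.
case: z => [w v]; rewrite /form_decentralized /=.
have := dirichlet_energy_ge0 Rinv_pos (fun j => v j 0).
rewrite -(laplacian_energy eR_sym Rinv_pos) -/LR => E0.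
rewrite -subr_ge0 -opprD oppr_ge0 -big_split /=.
(* The gap between the two sides is exactly the loss in the DC lines. *)
rewrite [leLHS](_ : _ = - (Vnom * \sum_i v i 0 * LR (fun j => v j 0) i)).
  by rewrite oppr_le0 mulr_ge0 // ltW.
rewrite mulr_sumr -sumrN; apply: eq_bigr => i _.
rewrite voltage_fieldE mxE /decentralized_injection /decentralized_generation.
by field; rewrite ?gt_eqF.
Qed.

(** Differentiating the cross term gives the damping of [h] through the frequency equation, and [w]
    against the Laplacian of [h] through the integrator. The latter is paid for by the energy of the
    communication graph, whence the degree in the coefficient of [w ^+ 2]. *)
Lemma form_distributed_dissipation (eps : R)
    (z : 'cV[R]_n * 'cV[R]_n * 'cV[R]_n) : 0 < eps -> eps <= 1 ->
  form_distributed eps z (fb0 z) <=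
  - \sum_i (Komega i / KV i * Kdroop i * z.1.1 i 0 ^+ 2
            + (Komega i * z.1.1 i 0 - KV i * z.1.2 i 0) ^+ 2 / KV i
            + eps * (KdroopI i * KV i / Komega i * z.2 i 0 ^+ 2
                     + z.2 i 0 * ((Kdroop i + Komega i) * z.1.1 i 0
                                  + - KV i * z.1.2 i 0)
                     - (m i * KdroopI i
                        + m i ^+ 2 * \sum_(j | eeta i j) ceta i j)
                       * z.1.1 i 0 ^+ 2)).
Proof.
move=> e0 e1; case: z => [[w v] h]; rewrite /form_distributed /=.
have := dirichlet_energy_ge0 Rinv_pos (fun j => v j 0).
rewrite -(laplacian_energy eR_sym Rinv_pos) -/LR => E0.
have := laplacian_cross_term ceta_pos (fun i => eps * m i * w i 0)
  (fun j => h j 0).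
rewrite -(laplacian_energy eeta_sym ceta_pos) -/Leta /= => E1.
have deg_ge0 i : 0 <= \sum_(j | eeta i j) ceta i j.
  by apply: sumr_ge0 => j /ceta_pos[c0 _]; exact: ltW.
(* Young's inequality leaves [eps ^+ 2 / 2]; it is relaxed to [eps] so that [eps] factors out of the
   whole correction. *)
have E2 : 2^-1 *
    \sum_i (\sum_(j | eeta i j) ceta i j) * (eps * m i * w i 0) ^+ 2 <=
    eps * \sum_i (\sum_(j | eeta i j) ceta i j) * (m i * w i 0) ^+ 2.
  rewrite !mulr_sumr; apply: ler_sum => i _.
  set D := \sum_(j | eeta i j) _.
  have : 0 <= (1 - eps + 1) * eps * (D * (m i * w i 0) ^+ 2).
    by rewrite !(sqr_ge0, deg_ge0, ltW e0, subr_ge0, e1, ler01,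
      mulr_ge0, addr_ge0).
  lra.
have VE0 : 0 <= Vnom * \sum_i v i 0 * LR (fun j => v j 0) i.
  by rewrite mulr_ge0 // ltW.
rewrite -subr_ge0 -opprD oppr_ge0 -big_split /=.
rewrite [leLHS](_ : _ = - (Vnom * \sum_i v i 0 * LR (fun j => v j 0) i)
   - \sum_i eps * m i * w i 0 * Leta (fun j => h j 0) i
   - \sum_i h i 0 * Leta (fun j => h j 0) i
   - eps * \sum_i (\sum_(j | eeta i j) ceta i j) * (m i * w i 0) ^+ 2).
  lra.
rewrite !mulr_sumr -!sumrN -!big_split /=; apply: eq_bigr => i _.
rewrite voltage_fieldE integrator_fieldE mxE.
rewrite /decentralized_injection /distributed_generation.
by field; rewrite ?gt_eqF.
Qed.


(** * Contraction and stability of both closed loops *)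

Lemma contraction_decentralized : exists c k : R, [/\ 0 < c, 0 < k,
  forall z, `|z| ^+ 2 <= c * form_decentralized z z &
  forall y z, form_decentralized (y - z) (fa y - fa z) <=
              - k * form_decentralized (y - z) (y - z)].
Proof.
have [||| k k0 kP] := @nodewise_contraction R n (R * R)
  (fun i x => x.1 ^+ 2 + x.2 ^+ 2)
  (fun i x => Komega i / KV i * m i * (x.1 * x.1) + Vnom * C i * (x.2 * x.2))
  (fun i x => Komega i / KV i * Kdroop i * x.1 ^+ 2
              + (Komega i * x.1 - KV i * x.2) ^+ 2 / KV i).
- by move=> i x; rewrite addr_ge0 ?sqr_ge0.
- move=> i.
  (* Without integrator this is the case [h = 0], where the cross term disappears whatever [eps]
     is. *)
  have [eps e0 /(_ _ e0 (lexx _))[k k0 kP]] := node_storage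
    (mulr_gt0 (gain i) (m_gt0 i)) (mulr_gt0 Vnom_gt0 (C_gt0 i)) (m_gt0 i).
  exists k => // x; have := kP x.1 x.2 0.
  by rewrite /= expr0n /= !(mulr0, mul0r, addr0) -!expr2.
- move=> i; have [d d0 dP] := node_dissipation
    (mulr_gt0 (gain i) (Kdroop_gt0 i)) (Komega_gt0 i) (KV_gt0 i).
  by exists d.
exists k^-1, (k ^+ 2); split; rewrite ?invr_gt0 ?exprn_gt0 //.
  move=> z; rewrite mulrC ler_pdivlMr // mulrC.
  have [kN _] := kP (fun i => (z.1 i 0, z.2 i 0)); apply: le_trans kN.
  rewrite ler_pM2l // big_split /=; apply: le_trans (prod_norm_sqr_le z) _.
  by apply: lerD; exact: cV_norm_sqr_le.
move=> y z; rewrite closed_loop_decentralizedB; set d := y - z.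
have [_ kW] := kP (fun i => (d.1 i 0, d.2 i 0)).
by apply: le_trans (form_decentralized_dissipation d) _; rewrite mulNr lerN2.
Qed.

Lemma contraction_distributed : exists eps c k : R, [/\ 0 < c, 0 < k,
  forall z, `|z| ^+ 2 <= c * form_distributed eps z z &
  forall y z, form_distributed eps (y - z) (fb y - fb z) <=
              - k * form_distributed eps (y - z) (y - z)].
Proof.
pose N (i : 'I_n) (x : R * R * R) : R := x.1.1 ^+ 2 + x.1.2 ^+ 2 + x.2 ^+ 2.
pose W eps i (x : R * R * R) := Komega i / KV i * m i * (x.1.1 * x.1.1)
  + Vnom * C i * (x.1.2 * x.1.2) + x.2 * x.2
  + eps * m i * (x.1.1 * x.2 + x.2 * x.1.1).
pose D eps i (x : R * R * R) := Komega i / KV i * Kdroop i * x.1.1 ^+ 2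
  + (Komega i * x.1.1 - KV i * x.1.2) ^+ 2 / KV i
  + eps * (KdroopI i * KV i / Komega i * x.2 ^+ 2
           + x.2 * ((Kdroop i + Komega i) * x.1.1 + - KV i * x.1.2)
           - (m i * KdroopI i + m i ^+ 2 * \sum_(j | eeta i j) ceta i j)
             * x.1.1 ^+ 2).
(* [eps] enters the form itself, so it must be common to all nodes before any rate is chosen.
   Quantifying over all smaller [eps] makes the property pass to smaller thresholds. *)
have [||eps0 eps00 eps0P] := @uniform_pos_bound R n (fun i e =>
  forall eps, 0 < eps -> eps <= e ->
  (exists2 k, 0 < k &
    forall x, k * N i x <= W eps i x /\ k * W eps i x <= N i x) /\
  (exists2 k, 0 < k & forall x, k * N i x <= D eps i x)).
- by move=> i k k' _ kk' Pk eps e0 ek; apply: Pk => //; exact: le_trans kk'.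
- move=> i; have [e1 e10 e1P] := node_storage
    (mulr_gt0 (gain i) (m_gt0 i)) (mulr_gt0 Vnom_gt0 (C_gt0 i)) (m_gt0 i).
  have M_ge0 : 0 <= m i * KdroopI i + m i ^+ 2 * \sum_(j | eeta i j) ceta i j.
    rewrite addr_ge0 ?mulr_ge0 ?(ltW (m_gt0 i)) ?(ltW (KdroopI_gt0 i)) //.
    by apply: sumr_ge0 => j /ceta_pos[c0 _]; exact: ltW.
  have [e2 e20 e2P] := node_dissipation_integral (Kdroop i + Komega i) (- KV i)
    (mulr_gt0 (gain i) (Kdroop_gt0 i)) (Komega_gt0 i) (KV_gt0 i)
    (divr_gt0 (mulr_gt0 (KdroopI_gt0 i) (KV_gt0 i)) (Komega_gt0 i)) M_ge0.
  exists (Num.min e1 e2) => [|eps e0]; first by rewrite lt_min e10.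
  rewrite le_min => /andP[ee1 ee2]; split.
    have [k k0 kP] := e1P _ e0 ee1; exists k => // x.
    by have := kP x.1.1 x.1.2 x.2; rewrite /= !expr2.
  have [k k0 kP] := e2P _ e0 ee2; exists k => // x.
  exact: kP.
(* The cap 1 is the condition of [form_distributed_dissipation]. *)
pose eps := Num.min eps0 1.
have e0 : 0 < eps by rewrite lt_min eps00 ltr01.
have [ee0 e1] : eps <= eps0 /\ eps <= 1 by rewrite /eps !ge_min !lexx orbT.
have [||| k k0 kP] := @nodewise_contraction R n _ N (W eps) (D eps).
- by move=> i x; rewrite !addr_ge0 ?sqr_ge0.
- by move=> i; have [] := eps0P i _ e0 ee0.
- by move=> i; have [] := eps0P i _ e0 ee0.
exists eps, k^-1, (k ^+ 2); split; rewrite ?invr_gt0 ?exprn_gt0 //.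
  move=> z; rewrite mulrC ler_pdivlMr // mulrC.
  have [kN _] := kP (fun i => (z.1.1 i 0, z.1.2 i 0, z.2 i 0)).
  apply: le_trans kN.
  rewrite ler_pM2l // /N !big_split /=; apply: le_trans (prod_norm_sqr_le z) _.
  apply: lerD; last exact: cV_norm_sqr_le.
  apply: le_trans (prod_norm_sqr_le z.1) _.
  by apply: lerD; exact: cV_norm_sqr_le.
move=> y z; rewrite closed_loop_distributedB; set d := y - z.
have [_ kW] := kP (fun i => (d.1.1 i 0, d.1.2 i 0, d.2 i 0)).
apply: le_trans (form_distributed_dissipation d e0 e1) _.
by rewrite mulNr lerN2.
Qed.

Lemma decentralized_stability :
  (exists xe, is_equilibrium fa xe) /\
  (forall xe, is_equilibrium fa xe -> globally_asymptotically_stable fa xe).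
Proof.
have [c [k [c0 k0 coer contr]]] := contraction_decentralized.
have polar := form_decentralized_polar; split.
  apply: (affine_injective_zero closed_loop_decentralized_linear
    closed_loop_decentralizedB).
  exact: (contracting_injective k0 polar coer c0 contr).
exact: (contracting_gas k0 polar coer c0 contr).
Qed.

Lemma distributed_stability :
  (exists xe, is_equilibrium fb xe) /\
  (forall xe, is_equilibrium fb xe -> globally_asymptotically_stable fb xe).
Proof.
have [eps [c [k [c0 k0 coer contr]]]] := contraction_distributed.
have polar := form_distributed_polar eps; split.
  apply: (affine_injective_zero closed_loop_distributed_linear
    closed_loop_distributedB).
  exact: (contracting_injective k0 polar coer c0 contr).
exact: (contracting_gas k0 polar coer c0 contr).
Qed.

End ClosedLoops.

Theorem corollary3 (R : realType) (n : nat)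
    (eR ephi eeta : rel 'I_n)
    (Rline cphi ceta : 'I_n -> 'I_n -> R)
    (C m Pm Komega KV Kdroop KdroopI Vref : 'I_n -> R)
    (Vnom omega_ref gamma kphi : R)
    (eR_simple : simple_graph eR)
    (eR_connected : connected_graph eR)
    (Rline_pos : positive_symmetric_on eR Rline)
    (ephi_simple : simple_graph ephi)
    (cphi_pos : positive_symmetric_on ephi cphi)
    (eeta_simple : simple_graph eeta)
    (ceta_pos : positive_symmetric_on eeta ceta)
    (C_gt0 : forall i, 0 < C i)
    (m_gt0 : forall i, 0 < m i)
    (Vnom_gt0 : 0 < Vnom)
    (Komega_gt0 : forall i, 0 < Komega i)
    (KV_gt0 : forall i, 0 < KV i)
    (Kdroop_gt0 : forall i, 0 < Kdroop i)
    (KdroopI_gt0 : forall i, 0 < KdroopI i)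
    (Lphi_eq : weighted_laplacian ephi cphi =
       kphi *: weighted_laplacian eR (fun i j => (Rline i j)^-1))
    (gamma_gt : gamma > kphi / (4 * Vnom)) :
  let fa := closed_loop_decentralized eR Rline C m Pm Vnom
              Komega KV Kdroop omega_ref Vref in
  let fb := closed_loop_distributed eR Rline C m Pm Vnom
              Komega KV Kdroop KdroopI omega_ref Vref eeta ceta in
  ((exists xe, is_equilibrium fa xe) /\
   (forall xe, is_equilibrium fa xe -> globally_asymptotically_stable fa xe)) /\
  ((exists xe, is_equilibrium fb xe) /\
   (forall xe, is_equilibrium fb xe -> globally_asymptotically_stable fb xe)).
Proof.
split.
  by apply: decentralized_stability => //; case: eR_simple.
by apply: distributed_stability => //; [case: eR_simple|case: eeta_simple].
Qed.
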